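(* Let $I\subset K[x_1,\ldots,x_n]$ be a graded ideal and let $m<n$. Then there exists an open and dense subset $D\subset\Pi$ such that for every rational projection $\pi:\mathbb{R}^n\to\mathbb{R}^{m+1}$ whose class lies in $D$, and for any basis $u^{(1)},\ldots,u^{(l)}\in\mathbb{Z}^n$ ($l=n-m-1$) of $\ker\pi$, we have $\pi^{-1}\pi(T(I))=T(\tilde J_0)$ as sets, where $\tilde J_0$ is the ideal constructed from $I$ and $u^{(1)},\ldots,u^{(l)}$ as described in the context.
   Context: $K$ is an algebraically closed field of characteristic $0$ with trivial valuation. For $f=\sum_\nu a_\nu x^\nu$ and $\omega\in\mathbb{R}^n$, $\mathrm{in}_\omega(f)$ is the sum of the terms with $\omega\cdot\nu$ minimal, and for an ideal $I$, $T(I)=\{\omega\in\mathbb{R}^n:\mathrm{in}_\omega(f)\text{ is not a monomial for every }f\in I\}$. A rational projection is a linear map $\pi:\mathbb{R}^n\to\mathbb{R}^{m+1}$, $x\mapsto Ax$, with $A$ a rational matrix of maximal rank $m+1$. $\Pi$ is the set of equivalence classes of rational projections under $\pi\sim\pi'\iff\ker\pi=\ker\pi'$; it is identified with the set of rational (i.e. spanned by rational vectors) linear subspaces of $\mathbb{R}^n$ of dimension $n-m-1$. The topology on $\Pi$ is generated by the subbasis of sets $O_V=\{U\in\Pi:U\cap V=\{0\}\}$, $V$ ranging over rational subspaces of dimension $m+1$. Construction of $\tilde J_0$: in $K[x,\lambda,\mu]=K[x_1,\ldots,x_n,\lambda_1,\ldots,\lambda_l,\mu_1,\ldots,\mu_l]$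 put $t_k=x_k\prod_{u^{(j)}_k\geq 0}\lambda_j^{u^{(j)}_k}\prod_{u^{(j)}_k<0}\mu_j^{-u^{(j)}_k}$ for $k=1,\ldots,n$, let $J_0=(f(t_1,\ldots,t_n):f\in I)\subset K[x,\lambda,\mu]$, let $W=(\lambda_i\mu_i-1:i=1,\ldots,l)$, $\varphi:K[x,\lambda,\mu]\to K[x,\lambda,\mu]/W$ the canonical epimorphism, and, identifying $K[x_1,\ldots,x_n]$ with its (isomorphic) image under $\varphi$, set $\tilde J_0=\varphi(J_0)\cap K[x_1,\ldots,x_n]$. *)

(* Defs.v *)
From HB Require Import structures.
From mathcomp Require Import all_boot all_order all_algebra.
From mathcomp Require Import reals.
From mathcomp Require Import mpoly.

Set Implicit Arguments.
Unset Strict Implicit.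
Unset Printing Implicit Defensive.

Import Order.TTheory GRing.Theory Num.Theory.
Local Open Scope ring_scope.

Definition is_ideal (K : comNzRingType) (N : nat) (I : {mpoly K[N]} -> Prop) :=
  [/\ I 0,
      (forall f g, I f -> I g -> I (f + g)) &
      (forall a f, I f -> I (a * f))].

Definition ideal_gen (K : comNzRingType) (N : nat) (S : {mpoly K[N]} -> Prop)
    (g : {mpoly K[N]}) : Prop :=
  exists (k : nat) (a s : 'I_k -> {mpoly K[N]}),
    (forall i, S (s i)) /\ g = \sum_(i < k) a i * s i.

Definition hcomp (K : comNzRingType) (N : nat) (d : nat) (f : {mpoly K[N]}) :
    {mpoly K[N]} :=
  \sum_(nu <- msupp f | mdeg nu == d) f@_nu *: 'X_[nu].

Definition graded_ideal (K : comNzRingType) (N : nat) (I : {mpoly K[N]} -> Prop) :=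
  is_ideal I /\ forall f d, I f -> I (hcomp d f).

Definition wdot (R : realType) (n : nat) (w : 'rV[R]_n) (nu : 'X_{1..n}) : R :=
  \sum_(i < n) w 0 i * (nu i)%:R.

Definition initial_form (R : realType) (K : comNzRingType) (n : nat)
    (w : 'rV[R]_n) (f : {mpoly K[n]}) : {mpoly K[n]} :=
  \sum_(nu <- msupp f | all (fun nu' => wdot w nu <= wdot w nu') (msupp f))
     f@_nu *: 'X_[nu].

Definition is_monomial (K : comNzRingType) (n : nat) (p : {mpoly K[n]}) : bool :=
  size (msupp p) == 1%N.

Definition trop (R : realType) (K : comNzRingType) (n : nat)
    (I : {mpoly K[n]} -> Prop) (w : 'rV[R]_n) : Prop :=
  forall f, I f -> ~~ is_monomial (initial_form w f).

(* K[x, lambda, mu] = {mpoly K[n + l + l]}: variables x_1..x_n are the first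
   n, lambda_1..lambda_l the next l, mu_1..mu_l the last l.             *)

Section J0.
Variables (K : comNzRingType) (n l : nat).
Local Notation P := {mpoly K[n + l + l]}.

Definition xvar (k : 'I_n) : P := 'X_(lshift l (lshift l k)).
Definition lamvar (j : 'I_l) : P := 'X_(lshift l (rshift n j)).
Definition muvar (j : 'I_l) : P := 'X_(rshift (n + l) j).

Definition tvar (u : 'M[int]_(l, n)) (k : 'I_n) : P :=
  xvar k * \prod_(j < l)
     (if (0 <= u j k)%R then lamvar j ^+ `|u j k|%N else muvar j ^+ `|u j k|%N).

Definition xembed (g : {mpoly K[n]}) : P := g \mPo [tuple xvar k | k < n].

Definition J0 (I : {mpoly K[n]} -> Prop) (u : 'M[int]_(l, n)) : P -> Prop :=
  ideal_gen (fun h => exists2 f, I f & h = f \mPo [tuple tvar u k | k < n]).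

Definition Wid : P -> Prop :=
  ideal_gen (fun h => exists i : 'I_l, h = lamvar i * muvar i - 1).

(* tilde J_0 = phi(J_0) cap K[x], with phi : K[x,lambda,mu] -> K[x,lambda,mu]/W:
   g in K[x] lies in tilde J_0 iff phi(g) = phi(h) for some h in J_0,
   i.e. iff g = h + w with h in J_0 and w in W. *)
Definition Jtilde0 (I : {mpoly K[n]} -> Prop) (u : 'M[int]_(l, n))
    (g : {mpoly K[n]}) : Prop :=
  exists h w, J0 I u h /\ Wid w /\ xembed g = h + w.

End J0.

(* Subspaces of R^n are represented (mxalgebra) by square matrices
   U : 'M[R]_n through their row space; we use the canonical
   representative <<U>>, so that distinct representatives are distinct
   subspaces. *)

Definition rational_subspace (R : realType) (n : nat) (U : 'M[R]_n) : Prop :=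
  exists k (B : 'M[rat]_(k, n)), (U == map_mx (@ratr R) B)%MS.

Definition inPi (R : realType) (n m : nat) (U : 'M[R]_n) : Prop :=
  [/\ (<<U>> = U)%MS, rational_subspace U & \rank U = (n - m - 1)%N].

Definition subbasis_index (R : realType) (n m : nat) (V : 'M[R]_n) : Prop :=
  rational_subspace V /\ \rank V = m.+1.

Definition OV (R : realType) (n m : nat) (V U : 'M[R]_n) : Prop :=
  inPi m U /\ (U :&: V == (0 : 'M[R]_n))%MS.

(* Open sets of the topology generated by the subbasis: every point of D
   has a neighbourhood in D that is a finite intersection of subbasis sets
   (the empty intersection being Pi itself). *)
Definition Pi_open (R : realType) (n m : nat) (D : 'M[R]_n -> Prop) : Prop :=
  (forall U, D U -> inPi m U) /\
  forall U, D U ->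
    exists (Vs : seq 'M[R]_n),
      (forall V, V \in Vs -> subbasis_index m V) /\
      (forall V, V \in Vs -> OV m V U) /\
      (forall U', inPi m U' -> (forall V, V \in Vs -> OV m V U') -> D U').

Definition Pi_dense (R : realType) (n m : nat) (D : 'M[R]_n -> Prop) : Prop :=
  (forall U, D U -> inPi m U) /\
  forall O : 'M[R]_n -> Prop, Pi_open m O -> (exists U, O U) ->
    exists U, O U /\ D U.

Definition real_mx (R : realType) p q (A : 'M[rat]_(p, q)) : 'M[R]_(p, q) :=
  map_mx (@ratr R) A.

Definition proj (R : realType) (n m : nat) (A : 'M[rat]_(m.+1, n))
    (w : 'rV[R]_n) : 'rV[R]_m.+1 :=
  w *m (real_mx R A)^T.

Definition rational_projection (n m : nat) (A : 'M[rat]_(m.+1, n)) : bool :=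
  \rank A == m.+1.

(* ker pi as a subspace of R^n, in canonical form: its class in Pi. *)
Definition kerPi (R : realType) (n m : nat) (A : 'M[rat]_(m.+1, n)) : 'M[R]_n :=
  (<< kermx (real_mx R A)^T >>)%MS.

Definition int_mx (R : realType) p q (u : 'M[int]_(p, q)) : 'M[R]_(p, q) :=
  map_mx (fun z : int => z%:~R) u.

(* Main.v *)
(* With the weights [u nu] as grading, [Jtilde0 I u] consists of the g all of
   whose graded components lie in I.  This gives [T(I) + ker pi <= T(Jtilde0)]
   for every projection, so that D can be taken to be all of Pi.

   For the converse one passes to graded components one row v of u at a time.
   Suppose that for each s some f_s in I has a monomial as initial form at
   [w + s v]; a v-homogeneous element of I with a monomial as initial form at w
   is wanted.  Consider the elements of I of the form [x^nu + p] where p has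
   larger weight at [w + s v] and no larger v-degree than [x^nu].  For s very
   negative they exist by a Groebner basis argument, which uses that I is
   graded.  Two elements of I whose initial forms at a common point q are
   monomials, one well-behaved to the left of q and the other to its right, can
   be merged into one that is well-behaved on both sides, by the elimination of
   Chevalley's extension theorem for valuations.  Hence the existence propagates
   from very negative s to all s; merging with the mirrored statement for -v
   forces the v-degree to be constant. *)
Require Import Defs.
From HB Require Import structures.
From mathcomp Require Import all_boot all_order all_algebra.
From mathcomp Require Import boolp classical_sets reals.
From mathcomp Require Import mpoly.
From mathcomp Require Import ring lra zify.
Import Order.TTheory GRing.Theory Num.Theory.
Local Open Scope ring_scope.
Set Implicit Arguments.
Unset Strict Implicit.

(** * Parts of polynomials and ideals *)

Section Filter.
Variables (K : comNzRingType) (n : nat).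
Implicit Types (P Q : pred 'X_{1..n}) (f g : {mpoly K[n]}).

Definition mfilter P f : {mpoly K[n]} :=
  \sum_(nu <- msupp f | P nu) f@_nu *: 'X_[nu].

Lemma mcoeff_mfilter P f m : (mfilter P f)@_m = if P m then f@_m else 0.
Proof.
rewrite /mfilter raddf_sum /=.
under eq_bigr => nu _ do rewrite mcoeffZ mcoeffX.
have [mf|mf] := boolP (m \in msupp f); last first.
  rewrite memN_msupp_eq0 // if_same big_seq_cond big1 // => nu /andP[nuf _].
  by case: eqP => [e|]; rewrite ?mulr0 // -e nuf in mf *.
rewrite -big_filter; have [Pm|Pm] := boolP (P m).
  rewrite (bigD1_seq m) /= ?mem_filter ?Pm ?mf ?filter_uniq ?msupp_uniq //.
  rewrite eqxx mulr1 big1 ?addr0 // => nu /negPf nm.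
  by rewrite nm mulr0.
rewrite big_seq_cond big1 // => nu /andP[]; rewrite mem_filter => /andP[Pnu _] _.
by case: eqP => [e|]; rewrite ?mulr0 // -e Pnu in Pm *.
Qed.

Lemma msupp_mfilter P f m : (m \in msupp (mfilter P f)) = P m && (m \in msupp f).
Proof. by rewrite !mcoeff_msupp mcoeff_mfilter; case: (P m); rewrite ?eqxx. Qed.

Lemma mfilterC P f : mfilter P f + mfilter (predC P) f = f.
Proof.
apply/mpolyP => m; rewrite mcoeffD !mcoeff_mfilter /=.
by case: (P m); rewrite ?addr0 ?add0r.
Qed.

Lemma mfilter_linear P : linear (mfilter P).
Proof.
move=> a f g; apply/mpolyP => m.
rewrite !(mcoeffD, mcoeffZ, mcoeff_mfilter).
by case: (P m); rewrite ?mulr0 ?addr0.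
Qed.
HB.instance Definition _ P :=
  GRing.isLinear.Build K {mpoly K[n]} {mpoly K[n]} _ (mfilter P) (mfilter_linear P).

Lemma mfilterI P Q f : mfilter P (mfilter Q f) = mfilter (predI P Q) f.
Proof.
by apply/mpolyP => m; rewrite !mcoeff_mfilter /=; case: (P m); case: (Q m).
Qed.

Lemma eq_mfilter P Q f : P =1 Q -> mfilter P f = mfilter Q f.
Proof. by move=> e; apply/mpolyP => m; rewrite !mcoeff_mfilter e. Qed.

Lemma mfilter_id P f : {in msupp f, forall m, P m} -> mfilter P f = f.
Proof.
move=> Pf; apply/mpolyP => m; rewrite mcoeff_mfilter.
have [/Pf->//|mf] := boolP (m \in msupp f).
by rewrite memN_msupp_eq0 // if_same.
Qed.

Lemma mfilterX P m : mfilter P 'X_[m] = if P m then 'X_[m] else 0.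
Proof.
apply/mpolyP => k; rewrite mcoeff_mfilter [in RHS]fun_if mcoeffX mcoeff0.
by case: eqP => [->|]; rewrite ?if_same.
Qed.

End Filter.

Section Ideal.
Variables (K : comNzRingType) (n : nat) (I : {mpoly K[n]} -> Prop).
Hypothesis HI : is_ideal I.

Lemma ideal0 : I 0. Proof. by case: HI. Qed.
Lemma idealD f g : I f -> I g -> I (f + g). Proof. by case: HI => _ + _; apply. Qed.
Lemma idealM a f : I f -> I (a * f). Proof. by case: HI => _ _; apply. Qed.
Lemma idealZ c f : I f -> I (c *: f).
Proof. by rewrite -mul_mpolyC; exact: idealM. Qed.
Lemma idealB f g : I f -> I g -> I (f - g).
Proof. by move=> If Ig; rewrite -scaleN1r; apply/idealD/idealZ. Qed.
Lemma ideal_sum (T : Type) (r : seq T) (P : pred T) F :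
  (forall t, P t -> I (F t)) -> I (\sum_(t <- r | P t) F t).
Proof. by move=> IF; apply: big_ind; [exact: ideal0|exact: idealD|]. Qed.
End Ideal.

(** * Merging two elements of an ideal *)

(** Integrality of the degree turns a strict bound into a gap of 1, the amount gained in each
    elimination step. *)
Lemma intr_ltN_le (R : realDomainType) (k : int) (d : nat) :
  k%:~R < - d%:R :> R -> k%:~R <= - d%:R - 1 :> R.
Proof.
have -> : - d%:R = (- d%:Z)%:~R :> R by rewrite mulrNz.
rewrite ltr_int => h.
have -> : (- d%:Z)%:~R - 1 = (- d%:Z - 1)%:~R :> R by rewrite rmorphB.
by rewrite ler_int; lia.
Qed.

Section Merge.
Variables (R : realType) (K : comNzRingType) (n : nat) (I : {mpoly K[n]} -> Prop).
Hypothesis HI : is_ideal I.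
Variable L : 'X_{1..n} -> R.
Hypothesis LD : forall a b, L (a + b)%MM = L a + L b.
Implicit Types (i : 'X_{1..n} -> int) (C : R -> R -> bool).

(* C constrains the weight and the degree of [mu - nu], for mu a term of p. *)
Definition tail i C nu (p : {mpoly K[n]}) :=
  forall mu, mu \in msupp p -> C (L mu - L nu) (i mu - i nu)%:~R.

Definition monic_with i C := exists nu p, I ('X_[nu] + p) /\ tail i C nu p.

Lemma tailD i C nu p q : tail i C nu p -> tail i C nu q -> tail i C nu (p + q).
Proof. by move=> hp hq mu /msuppD_le; rewrite mem_cat => /orP[/hp|/hq]. Qed.

Lemma tailN i C nu p : tail i C nu p -> tail i C nu (- p).
Proof. by move=> hp mu; rewrite (perm_mem (msuppN p)) => /hp. Qed.

Lemma tailM i (C C' C'' : R -> R -> bool) nu rho p q :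
  (forall a b, i (a + b)%MM = i a + i b) ->
  (forall x k x' k', C x k%:~R -> C' x' k'%:~R -> C'' (x + x') (k + k')%:~R) ->
  tail i C nu p -> tail i C' rho q -> tail i C'' (nu + rho)%MM (p * q).
Proof.
move=> iD CC hp hq mu /msuppM_le /allpairsP[[a b] /= [ap bq ->]].
rewrite !LD !iD.
have -> : L a + L b - (L nu + L rho) = (L a - L nu) + (L b - L rho) by ring.
have -> : i a + i b - (i nu + i rho) = (i a - i nu) + (i b - i rho) by ring.
exact: CC (hp _ ap) (hq _ bq).
Qed.

Lemma tailX i (C : R -> R -> bool) rho nu p :
  (forall a b, i (a + b)%MM = i a + i b) ->
  tail i C nu p -> tail i C (rho + nu)%MM ('X_[rho] * p).
Proof.
move=> iD; apply: (@tailM i (fun x k => (x == 0) && (k == 0))) => //.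
  by move=> x k x' k' /andP[/eqP-> /eqP k0]; rewrite rmorphD /= k0 !add0r.
by move=> mu; rewrite msuppX inE => /eqP->; rewrite !subrr !eqxx.
Qed.

Lemma sub_tail i (C C' : R -> R -> bool) nu p :
  (forall x k, C x k%:~R -> C' x k%:~R) -> tail i C nu p -> tail i C' nu p.
Proof. by move=> CC hp mu /hp /CC. Qed.

Lemma tail_mfilter i C C' nu p : tail i C' nu p ->
  tail i (fun x k => C x k && C' x k) nu
    (mfilter (fun mu => C (L mu - L nu) (i mu - i nu)%:~R) p).
Proof. by move=> hp mu; rewrite msupp_mfilter => /andP[-> /hp]. Qed.

(** Let [L] be the weight at the parameter q. At q - t a term has weight [x - t * k] relative to
    [nu], and [k <= be * x] keeps this positive for 0 <= t < 1/be, or for all t >= 0 if be = 0. The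
    bound [- k <= al * x] does the same to the right of q; [coneR_upto] lets it fail by at most
    [d]. *)
Definition coneR (be x k : R) := (0 < x) && (k <= be * x).
Definition coneLR (al be x k : R) := [&& 0 < x, k <= be * x & - k <= al * x].
Definition coneR_upto (al be : R) (d : nat) (x k : R) :=
  [&& 0 < x, k <= be * x & - d%:R <= al * x + k].

(* With p = p0 + p1 and q = q0 + q1 split into good and bad terms, the element
   [(x^rho + q0) (x^nu + p) - p1 (x^rho + q)] of I has lost the products q0 p1:
   the bad terms of p only survive multiplied by bad terms of q, whose degree is
   at least 1. *)
Lemma merge_step i al be nu rho p q (d e : nat) :
  (forall a b, i (a + b)%MM = i a + i b) -> 0 <= al -> 0 <= be -> (e <= d.+1)%N ->
  I ('X_[nu] + p) -> tail i (coneR_upto al be d.+1) nu p ->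
  I ('X_[rho] + q) -> tail i (fun x k => coneR_upto be al e x (- k)) rho q ->
  exists2 r, I ('X_[rho + nu] + r) & tail i (coneR_upto al be d) (rho + nu)%MM r.
Proof.
move=> iD al0 be0 ed Ip hp Iq hq.
pose P mu := coneR_upto al be d (L mu - L nu) (i mu - i nu)%:~R.
pose Q mu := coneLR al be (L mu - L rho) (i mu - i rho)%:~R.
pose p0 := mfilter P p; pose p1 := mfilter (predC P) p.
pose q0 := mfilter Q q; pose q1 := mfilter (predC Q) q.
have hp0 : tail i (coneR_upto al be d) nu p0.
  by apply: sub_tail (tail_mfilter (C := coneR_upto al be d) hp) => x k /andP[].
have hp1 := tail_mfilter (C := fun x k => ~~ coneR_upto al be d x k) hp.
have hq0 : tail i (coneLR al be) rho q0.
  by apply: sub_tail (tail_mfilter (C := coneLR al be) hq) => x k /andP[].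
have hq1 := tail_mfilter (C := fun x k => ~~ coneLR al be x k) hq.
exists ('X_[rho] * p0 + 'X_[nu] * q0 + q0 * p0 - p1 * q1).
  suff -> : 'X_[rho + nu] + ('X_[rho] * p0 + 'X_[nu] * q0 + q0 * p0 - p1 * q1) =
     ('X_[rho] + q0) * ('X_[nu] + p) - p1 * ('X_[rho] + q).
    by apply: idealB => //; apply: idealM.
  rewrite -(mfilterC P p) -(mfilterC Q q) -/p0 -/p1 -/q0 -/q1 mpolyXD; ring.
have LRR x k : coneLR al be x k -> coneR_upto al be d x k.
  case/and3P=> x0 kb ka; apply/and3P; split=> //.
  have : 0 <= d%:R :> R by [].
  by lra.
apply: tailD; [apply: tailD; [apply: tailD|]|apply: tailN].
- exact: tailX.
- rewrite addmC; apply: tailX => //; apply: sub_tail hq0 => x k; exact: LRR.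
- apply: tailM hq0 hp0 => // x k x' k' /and3P[x0 kb ka] /and3P[x0' kb' ka'].
  by apply/and3P; rewrite rmorphD /=; split; lra.
rewrite addmC; apply: tailM hp1 hq1 => // x k x' k'.
rewrite /coneR_upto /coneLR => /andP[+ /and3P[x0 kb kd]] /andP[+ /and3P[x0' kb' ke]].
rewrite x0 kb x0' kb' /= andbT -!ltNge => h1 h2.
(* The bad term of [p] has k <= -d - 1, which absorbs the excess e <= d + 1 of [q] over slope [be].
   The bad term of [q] has k' >= 1, which lowers the defect of [p] from d + 1 to d. *)
have k1 : k%:~R <= - d%:R - 1 :> R by apply: intr_ltN_le; have := mulr_ge0 al0 (ltW x0); lra.
have k2 : 1 <= k'%:~R :> R.
  suff : 0 < k'%:~R :> R by rewrite ltr0z ler1z.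
  by have := mulr_ge0 be0 (ltW x0'); lra.
have : e%:R <= d%:R + 1 :> R by rewrite -[1]/(1%:R) -natrD ler_nat addn1.
move=> edR; rewrite -natr1 in kd.
have := mulr_ge0 al0 (ltW x0'); have := mulr_ge0 be0 (ltW x0) => ? ?.
by apply/and3P; rewrite rmorphD /=; split; lra.
Qed.

(** Induction on the total defect d + e: [merge_step] lowers the larger one, and defect 0 on either
    side already gives [coneLR]. Negating [i] exchanges the roles of [p] and [q] and of [al] and
    [be], so all of these vary in the induction. *)
Lemma merge_upto N : forall (d e : nat) i al be nu rho p q,
  (d + e <= N)%N ->
  (forall a b, i (a + b)%MM = i a + i b) -> 0 <= al -> 0 <= be ->
  I ('X_[nu] + p) -> tail i (coneR_upto al be d) nu p ->
  I ('X_[rho] + q) -> tail i (fun x k => coneR_upto be al e x (- k)) rho q ->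
  monic_with i (coneLR al be).
Proof.
have d0 i al be nu p : I ('X_[nu] + p) -> tail i (coneR_upto al be 0) nu p ->
    monic_with i (coneLR al be).
  move=> Ip hp; exists nu, p; split=> //; apply: sub_tail hp => x k /and3P[x0 kb ka].
  by apply/and3P; split=> //; lra.
have symm i al be : monic_with (fun m => - i m) (coneLR be al) ->
    monic_with i (coneLR al be).
  move=> [nu [p [Ip hp]]]; exists nu, p; split=> // mu /hp /and3P[x0].
  rewrite -opprD rmorphN /= => kb ka.
  by apply/and3P; split=> //; lra.
have tailsym i C nu q : tail i (fun x k => C x (- k)) nu q -> tail (fun m => - i m) C nu q.
  by move=> hq mu /hq; rewrite -opprD rmorphN.
elim: N => [|N IHN] d e i al be nu rho p q deN iD al0 be0 Ip hp Iq hq.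
  by move: deN hp; rewrite leqn0 addn_eq0 => /andP[/eqP-> _]; exact: d0.
have iD' a b : - i (a + b)%MM = - i a - i b by rewrite iD opprD.
have hp' : tail (fun m => - i m) (fun x k => coneR_upto al be d x (- k)) nu p.
  by move=> mu /hp; rewrite -opprD rmorphN /= opprK.
case: d hp hp' deN => [|d] hp hp' deN; first exact: d0 Ip hp.
case: e hq deN => [|e] hq deN; first by apply: symm; apply: d0 Iq (tailsym _ _ _ _ hq).
have [ed|de] := leqP e d.
  have [r Ir hr] := merge_step iD al0 be0 (ed : e.+1 <= d.+1)%N Ip hp Iq hq.
  by apply: IHN iD al0 be0 Ir hr Iq hq; lia.
have [r Ir hr] := merge_step iD' be0 al0 (ltnW de : d.+1 <= e.+1)%N Iq (tailsym _ _ _ _ hq) Ip hp'.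
apply: symm; apply: IHN iD' be0 al0 Ir hr Ip hp'; lia.
Qed.

Lemma exists_natr_bound (T : eqType) (s : seq T) (F : T -> R) :
  exists d : nat, {in s, forall t, F t <= d%:R}.
Proof.
elim: s => [|a s [d hd]]; first by exists 0%N.
exists (d + (Num.truncn (F a)).+1)%N => t; rewrite inE natrD => /orP[/eqP->|/hd h].
  by apply: le_trans (ltW (truncnS_gt _)) _; rewrite lerDr.
by apply: le_trans h _; rewrite lerDl.
Qed.

(** Having finitely many terms, each polynomial violates its missing bound by at most some natural
    number, the initial defect. *)
Lemma monic_merge i al be :
  (forall a b, i (a + b)%MM = i a + i b) -> 0 <= al -> 0 <= be ->
  monic_with i (coneR be) -> monic_with i (fun x k => coneR al x (- k)) ->
  monic_with i (coneLR al be).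
Proof.
move=> iD al0 be0 [nu [p [Ip hp]]] [rho [q [Iq hq]]].
have [d hd] := exists_natr_bound (msupp p) (fun m => - (i m - i nu)%:~R).
have [e he] := exists_natr_bound (msupp q) (fun m => (i m - i rho)%:~R).
apply: (merge_upto (leqnn (d + e)%N) iD al0 be0 Ip _ Iq) => mu mup.
- have /andP[x0 kb] := hp _ mup; have := hd _ mup => /= h.
  have := mulr_ge0 al0 (ltW x0) => ?.
  by apply/and3P; split=> //; lra.
- have /andP[x0 kb] := hq _ mup; have := he _ mup => /= h.
  have := mulr_ge0 be0 (ltW x0) => ?.
  by apply/and3P; split=> //; lra.
Qed.

End Merge.

(** * Propagation along the line w + s v *)

Section Sweep.
Variables (R : realType) (K : comNzRingType) (n : nat) (I : {mpoly K[n]} -> Prop).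
Hypothesis HI : is_ideal I.
Variable L0 : 'X_{1..n} -> R.
Hypothesis L0D : forall a b, L0 (a + b)%MM = L0 a + L0 b.
Implicit Type i : 'X_{1..n} -> int.

(* The weight [w + s v], for [L0] given by w and i by v. *)
Definition sheared i (s : R) (m : 'X_{1..n}) : R := L0 m + s * (i m)%:~R.

Definition positive_at i s := monic_with I (sheared i s) i (fun x _ => 0 < x).
Definition left_positive i s := monic_with I (sheared i s) i (coneR 0).

Lemma shearedD i s : (forall a b, i (a + b)%MM = i a + i b) ->
  forall a b, sheared i s (a + b)%MM = sheared i s a + sheared i s b.
Proof. by move=> iD a b; rewrite /sheared L0D iD rmorphD /=; ring. Qed.

Lemma shearedB i s t a b : sheared i t a - sheared i t b =
  (sheared i s a - sheared i s b) + (t - s) * (i a - i b)%:~R.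
Proof. by rewrite /sheared rmorphB /=; ring. Qed.

Lemma left_positive_le i s t : t <= s -> left_positive i s -> left_positive i t.
Proof.
move=> ts [nu [p [Ip hp]]]; exists nu, p; split=> // mu /hp /andP[].
rewrite mul0r (shearedB i s t) => x0 k0; apply/andP; split; last by rewrite mul0r.
have : 0 <= (t - s) * (i mu - i nu)%:~R by rewrite mulr_le0 ?subr_le0.
by lra.
Qed.

Lemma exists_shift_bound (T : eqType) (r : seq T) (x k : T -> R) :
  {in r, forall t, 0 < x t} ->
  exists2 eps, 0 < eps & {in r, forall t, eps * `|k t| < x t}.
Proof.
elim: r => [|a r IH] hx; first by exists 1.
have [|eps e0 he] := IH; first by move=> t tr; apply: hx; rewrite inE tr orbT.
have xa : 0 < x a by apply: hx; rewrite inE eqxx.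
have d0 : 0 < 1 + `|k a| by have := normr_ge0 (k a); lra.
have y0 : 0 < x a / (1 + `|k a|) by rewrite divr_gt0.
exists (Num.min eps (x a / (1 + `|k a|))); first by rewrite lt_min e0.
move=> t; rewrite inE => /predU1P[->|/he]; last first.
  by apply: le_lt_trans; rewrite ler_wpM2r // ge_min lexx.
have : x a / (1 + `|k a|) * `|k a| < x a.
  by rewrite mulrAC ltr_pdivrMr // ltr_pM2l //; lra.
by apply: le_lt_trans; rewrite ler_wpM2r // ge_min lexx orbT.
Qed.

(** [eps] is a distance over which the term witnessing positivity at [s0] stays strictly minimal; it
    is independent of [q]. Merging this witness at [q] with a left positive element carries left
    positivity past [s0]. *)
Lemma left_positive_extend i s0 : (forall a b, i (a + b)%MM = i a + i b) ->
  positive_at i s0 ->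
  exists2 eps, 0 < eps &
    forall q, s0 - eps < q -> q <= s0 -> left_positive i q ->
      left_positive i (s0 + eps / 2).
Proof.
move=> iD [nu [p [Ip hp]]].
have [eps e0 he] := exists_shift_bound (fun m => (i m - i nu)%:~R) hp.
exists eps => // q hq hq' lq.
have r0 : 0 < s0 + eps - q by lra.
have ri0 : 0 <= (s0 + eps - q)^-1 by rewrite invr_ge0 ltW.
(* Seen from [q], the term [nu] stays minimal to the right up to distance s0 + eps - q, whence the
   inverse slope. *)
have lr : monic_with I (sheared i q) i (fun x k => coneR (s0 + eps - q)^-1 x (- k)).
  exists nu, p; split=> // mu mup; have {he} := he _ mup.
  rewrite (shearedB i s0 q); set k := _%:~R; set x := _ - _ => h.
  have kn : `|(q - s0) * k| < x.
    apply: le_lt_trans h; rewrite normrM ler_wpM2r // ler_norml; lra.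
  have kn' : `|eps * k| < x by rewrite normrM gtr0_norm.
  move: kn kn'; rewrite !ltr_norml => /andP[k1 k2] /andP[k3 k4].
  apply/andP; split; first by lra.
  by rewrite ler_pdivlMl //; lra.
have [rho [g [Ig hg]]] := monic_merge HI (shearedD q iD) iD ri0 (lexx 0) lq lr.
exists rho, g; split=> // mu /hg /and3P[].
rewrite (shearedB i q (s0 + eps / 2)); set k := _%:~R; set x := _ - _.
rewrite mul0r ler_pdivlMl // => x0 k0 xk; apply/andP; split; last by rewrite mul0r.
(* The cone gives only a weak inequality at s0 + eps; at s0 + eps/2 it becomes strict because k <
   0. *)
have [k00|kn0] := eqVneq k 0; first by rewrite k00 mulr0 addr0.
have : eps * k < 0 by rewrite pmulr_rlt0 // lt_neqAle kn0.
by lra.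
Qed.

(** The parameters with a left positive element form a down-set. Were it bounded, an element close
    to its supremum would extend beyond it by eps/2. *)
Lemma left_positive_all i : (forall a b, i (a + b)%MM = i a + i b) ->
  (forall s, positive_at i s) -> (exists s, left_positive i s) ->
  forall s, left_positive i s.
Proof.
move=> iD pos [s1 ls1] s; apply: contrapT => nls.
have E0 : has_sup (left_positive i).
  split; first by exists s1.
  exists s => t lt; rewrite leNgt; apply/negP => /ltW st.
  exact: nls (left_positive_le st lt).
have [eps e0 he] := left_positive_extend iD (pos (sup (left_positive i))).
have [q lq qs] := sup_adherent e0 E0.
have /(ub_le_sup E0.2) := he q qs (ub_le_sup E0.2 lq) lq.
by lra.
Qed.

Lemma positive_atN i : (forall s, positive_at i s) ->
  forall s, positive_at (fun m => - i m) s.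
Proof.
move=> pos s; have [nu [p [Ip hp]]] := pos (- s); exists nu, p; split=> // mu /hp.
by rewrite /sheared !rmorphN /= !mulrN !mulNr.
Qed.

(** At s = 0 the two one-sided witnesses bound the degree from opposite sides; merging with both
    slopes 0 leaves only k = 0. *)
Lemma monic_homogeneous i : (forall a b, i (a + b)%MM = i a + i b) ->
  (forall s, positive_at i s) ->
  (exists s, left_positive i s) -> (exists s, left_positive (fun m => - i m) s) ->
  monic_with I L0 i (fun x k => (0 < x) && (k == 0)).
Proof.
move=> iD pos lp rp.
have iD' a b : - i (a + b)%MM = - i a - i b by rewrite iD opprD.
have pos' := positive_atN pos.
have {lp}[nu [p [Ip hp]]] := left_positive_all iD pos lp 0.
have {rp}[rho [q [Iq hq]]] := left_positive_all iD' pos' rp 0.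
have hp' : monic_with I L0 i (coneR 0).
  by exists nu, p; split=> // mu /hp; rewrite /sheared !mul0r !addr0.
have hq' : monic_with I L0 i (fun x k => coneR 0 x (- k)).
  exists rho, q; split=> // mu /hq.
  by rewrite /sheared !mul0r !addr0 -opprD rmorphN.
have [sg [h [Ih hh]]] := monic_merge HI L0D iD (lexx 0) (lexx 0) hp' hq'.
exists sg, h; split=> // mu /hh /and3P[x0]; rewrite !mul0r => k1 k2.
by rewrite x0 eq_le k1; lra.
Qed.

End Sweep.

(** * Weights at infinity *)

(** Dickson's lemma by induction on the number [k] of coordinates compared. *)
Lemma dickson_upto (n k : nat) (S : 'X_{1..n} -> Prop) :
  exists2 B : seq 'X_{1..n}, {in B, forall b, S b} &
    forall m, S m -> exists2 b, b \in B & forall j : 'I_n, (j < k)%N -> (b j <= m j)%N.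
Proof.
elim: k S => [|k IH] S.
  have [[m Sm]|nS] := pselect (exists m, S m); last first.
    by exists [::] => // m Sm; case: nS; exists m.
  by exists [:: m] => [b|m' _]; [rewrite inE => /eqP->|exists m; rewrite ?inE].
have [nk|kn] := leqP n k.
  have [B SB hB] := IH S; exists B => // m /hB[b bB le].
  by exists b => // j _; apply: le; apply: leq_trans nk.
pose jk := Ordinal kn.
have [B SB hB] := IH S.
have slices N : exists2 Bs : seq 'X_{1..n}, {in Bs, forall b, S b} &
    forall m, S m -> (m jk < N)%N ->
      exists2 b, b \in Bs & forall j : 'I_n, (j < k.+1)%N -> (b j <= m j)%N.
  elim: N => [|N [Bs SBs hBs]]; first by exists [::].
  have [B' SB' hB'] := IH (fun m => S m /\ m jk = N).
  exists (B' ++ Bs) => [b|m Sm].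
    by rewrite mem_cat => /orP[/SB'[]|/SBs].
  rewrite ltnS leq_eqVlt => /orP[/eqP mN|/(hBs _ Sm)[b bBs le]]; last first.
    by exists b; rewrite ?mem_cat ?bBs ?orbT.
  have [b bB' le] := hB' m (conj Sm mN).
  exists b => [|j]; first by rewrite mem_cat bB'.
  rewrite ltnS leq_eqVlt => /orP[/eqP jk'|/le//].
  have -> : j = jk by apply: val_inj.
  by have [_ ->] := SB' _ bB'; rewrite mN.
(* Exponents whose new coordinate reaches this maximum are dominated through [B] itself; the others
   lie in finitely many slices, each treated by the induction hypothesis. *)
have [Bs SBs hBs] := slices (\max_(b <- B) b jk)%N.
exists (B ++ Bs) => [b|m Sm].
  by rewrite mem_cat => /orP[/SB|/SBs].
have [lt|ge] := ltnP (m jk) (\max_(b <- B) b jk)%N.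
  by have [b bB le] := hBs m Sm lt; exists b; rewrite ?mem_cat ?bB ?orbT.
have [b bB le] := hB m Sm; exists b => [|j]; first by rewrite mem_cat bB.
rewrite ltnS leq_eqVlt => /orP[/eqP jk'|/le//].
have -> : j = jk by apply: val_inj.
by apply: leq_trans ge; rewrite (big_rem b) //= leq_maxl.
Qed.

Lemma dickson (n : nat) (S : 'X_{1..n} -> Prop) :
  exists2 B : seq 'X_{1..n}, {in B, forall b, S b} &
    forall m, S m -> exists2 b, b \in B & (b <= m)%MM.
Proof.
have [B SB hB] := dickson_upto n S; exists B => // m /hB[b bB le].
by exists b => //; apply/mnm_lepP => j; exact: le.
Qed.

(** * Division by a Groebner basis for very negative s *)

Section AtInfinity.
Variables (R : realType) (K : fieldType) (n : nat) (I : {mpoly K[n]} -> Prop).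
Hypothesis HI : graded_ideal I.
Variables (L0 : 'X_{1..n} -> R) (i : 'X_{1..n} -> int).
Hypothesis L0D : forall a b, L0 (a + b)%MM = L0 a + L0 b.
Hypothesis iD : forall a b, i (a + b)%MM = i a + i b.

(* The limit of the weights [sheared s] for s to -oo, with ties broken; larger
   elements have smaller weight. *)
Definition below (a b : 'X_{1..n}) :=
  (i a < i b) || (i a == i b) && ((L0 b < L0 a) || (L0 a == L0 b) && (a < b)%O).

Lemma below_irr a : below a a = false.
Proof. by rewrite /below !ltxx !andbF. Qed.

Lemma below_trans : transitive below.
Proof.
move=> b a c; rewrite /below.
case/orP=> [ab|/andP[/eqP-> h1]]; case/orP=> [bc|/andP[/eqP ibc h2]].
- by rewrite (lt_trans ab bc).
- by rewrite -ibc ab.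
- by rewrite bc.
rewrite ibc eqxx /=; apply/orP; right.
case/orP: h1 h2 => [ab|/andP[/eqP-> h1]]; case/orP=> [bc|/andP[/eqP lbc h2]].
- by rewrite (lt_trans bc ab).
- by rewrite -lbc ab.
- by rewrite bc.
by rewrite lbc eqxx (lt_trans h1 h2) /= orbT.
Qed.

Lemma below_total a b : a != b -> below a b || below b a.
Proof.
move=> ab; rewrite /below; case: (ltgtP (i a) (i b)) => //= _.
by case: (ltgtP (L0 a) (L0 b)) => //= _; case: (ltgtP a b) ab.
Qed.

Lemma below_add c a b : below a b -> below (c + a)%MM (c + b)%MM.
Proof. by rewrite /below !iD !L0D !ltrD2l !(inj_eq (addrI _)) ltmc_add2r. Qed.

Lemma below_le a b : below a b -> i a <= i b.
Proof. by case/orP=> [/ltW//|/andP[/eqP-> _]]. Qed.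

Lemma below_sheared a b : below a b ->
  exists s1, forall s, s <= s1 -> sheared L0 i s b <= sheared L0 i s a.
Proof.
case/orP=> [ab|/andP[/eqP iab h]]; last first.
  exists 0 => s _; rewrite /sheared iab lerD2r.
  by case/orP: h => [/ltW//|/andP[/eqP-> _]].
(* The degrees differ by at least 1, so it suffices that -s dominates the difference of the
   weights. *)
exists (- `|L0 b - L0 a|) => s hs; rewrite -subr_ge0.
have -> : sheared L0 i s a - sheared L0 i s b =
    - s * (i b - i a)%:~R - (L0 b - L0 a) by rewrite /sheared rmorphB /=; ring.
have d1 : 1 <= (i b - i a)%:~R :> R by rewrite ler1z; lia.
have := ler_norm (L0 b - L0 a); have := normr_ge0 (L0 b - L0 a) => h0 h1.
have s0 : 0 <= - s by lra.
have := ler_wpM2l s0 d1; lra.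
Qed.

Definition leading (f : {mpoly K[n]}) mu :=
  mu \in msupp f /\ {in msupp f, forall m, m != mu -> below m mu}.

Lemma exists_leading f : f != 0 -> exists mu, leading f mu.
Proof.
rewrite -msupp_eq0 /leading; elim: (msupp f) => // a s IH _.
have [->|/IH[mu [mus hmu]]] := eqVneq s [::].
  exists a; rewrite inE; split=> // m; rewrite inE => /eqP->; by rewrite eqxx.
have [mu_a|] := boolP (below mu a).
  exists a; rewrite inE eqxx; split=> // m; rewrite inE => /predU1P[->|ms _].
    by rewrite eqxx.
  have [->//|/(hmu _ ms) mm] := eqVneq m mu; exact: below_trans mu_a.
move=> nmu_a; exists mu; rewrite inE mus orbT; split=> // m.
rewrite inE => /predU1P[->|/hmu//] /below_total.
by rewrite (negPf nmu_a) orbF.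
Qed.

Definition deg_homog d (f : {mpoly K[n]}) := {in msupp f, forall m, mdeg m = d}.

(** Fixing the total degree leaves finitely many exponents, so division terminates although [below]
    need not be a well-order. *)
Definition initial_monomial mu (f : {mpoly K[n]}) :=
  [/\ I f, deg_homog (mdeg mu) f, f@_mu = 1 & leading f mu].

Lemma leading_initial d f mu : I f -> deg_homog d f -> leading f mu ->
  initial_monomial mu ((f@_mu)^-1 *: f).
Proof.
move=> If df [muf hmu]; rewrite mcoeff_msupp in muf.
have e : msupp ((f@_mu)^-1 *: f) =i msupp f.
  by move=> m; rewrite (perm_mem (msuppZ _ _)) // invr_eq0.
split.
- exact: idealZ HI.1 _ _ If.
- by move=> m; rewrite e => /df->; rewrite (df mu) // mcoeff_msupp.
- by rewrite mcoeffZ mulVf.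
- by split=> [|m]; rewrite e; [rewrite mcoeff_msupp|exact: hmu].
Qed.

(* For very negative s the weight [sheared s] is refined by the order [below] on
   the finitely many terms of a Groebner basis. *)
Lemma exists_groebner : exists (B : seq 'X_{1..n}) (s1 : R),
  [/\ forall mu f, initial_monomial mu f -> exists2 b, b \in B & (b <= mu)%MM &
   {in B, forall b, exists2 g, initial_monomial b g &
     {in msupp g, forall m, sheared L0 i s1 b <= sheared L0 i s1 m}}].
Proof.
have [B SB hB] := dickson (fun mu => exists f, initial_monomial mu f).
exists B.
have [s1 hs1] : exists s1, {in B, forall b, exists2 g, initial_monomial b g &
     forall s, s <= s1 -> {in msupp g, forall m, sheared L0 i s b <= sheared L0 i s m}}.
  elim: B SB {hB} => [|b B IH] SB; first by exists 0.
  have [|s1 hs1] := IH; first by move=> c cB; apply: SB; rewrite inE cB orbT.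
  have [g [Ig dg g1 [bg lg]]] : exists f, initial_monomial b f.
    by apply: SB; rewrite inE eqxx.
  have [s2 hs2] : exists s2, {in msupp g, forall m, forall s, s <= s2 ->
      sheared L0 i s b <= sheared L0 i s m}.
    elim: (msupp g) lg => [|m r IHr] lg; first by exists 0.
    have [|s2 hs2] := IHr; first by move=> c cr; apply: lg; rewrite inE cr orbT.
    have [s3 hs3] : exists s3, forall s, s <= s3 -> sheared L0 i s b <= sheared L0 i s m.
      have [->|mb] := eqVneq m b; first by exists 0.
      by apply: below_sheared; apply: lg => //; rewrite inE eqxx.
    exists (Num.min s2 s3) => c cr s; rewrite le_min => /andP[l2 l3].
    by move: cr; rewrite inE => /predU1P[->|/hs2]; [exact: hs3|exact].
  exists (Num.min s1 s2) => c; rewrite inE => /predU1P[->|/hs1[g' ig' hg']].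
    exists g => // s; rewrite le_min => /andP[_ l2] m mg; exact: hs2.
  by exists g' => // s; rewrite le_min => /andP[l1 _]; exact: hg'.
exists s1; split=> [mu f imf|b /hs1[g ig hg]].
  by have [|b bB ble] := hB mu; [exists f|exists b].
by exists g => //; exact: hg.
Qed.

Definition centered s nu (f : {mpoly K[n]}) :=
  [/\ I f, deg_homog (mdeg nu) f, f@_nu = 1 &
      {in msupp f, forall m, m != nu -> sheared L0 i s nu < sheared L0 i s m}].

(** Gradedness of [I] allows passing to the component of the degree of [nu], where [nu] is still the
    strict minimum. *)
Lemma centered_of_positive s : positive_at I L0 i s -> exists nu f, centered s nu f.
Proof.
move=> [nu [p [Ip hp]]]; exists nu, (hcomp (mdeg nu) ('X_[nu] + p)).
have nup : nu \notin msupp p by apply/negP => /hp; rewrite subrr ltxx.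
have e : hcomp (mdeg nu) ('X_[nu] + p) =
  mfilter (fun m => mdeg m == mdeg nu) ('X_[nu] + p) by [].
rewrite /centered e; split.
- exact: (HI.2 _ (mdeg nu) Ip).
- by move=> m; rewrite msupp_mfilter => /andP[/eqP].
- by rewrite mcoeff_mfilter eqxx mcoeffD mcoeffX eqxx memN_msupp_eq0 ?addr0.
move=> m; rewrite msupp_mfilter => /andP[_ /msuppD_le].
by rewrite mem_cat msuppX inE => /orP[->//|/hp]; rewrite subr_gt0.
Qed.

(** As long as the leading exponent [mu] has larger degree than [nu], it is cancelled by a multiple
    of a basis element. At [s1] that multiple has only terms of weight at least that of [mu], hence
    above that of [nu], so the coefficient and the minimality of [nu] survive. *)
Lemma centered_reduce s1 (B : seq 'X_{1..n}) nu :
  (forall mu f, initial_monomial mu f -> exists2 b, b \in B & (b <= mu)%MM) ->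
  {in B, forall b, exists2 g, initial_monomial b g &
     {in msupp g, forall m, sheared L0 i s1 b <= sheared L0 i s1 m}} ->
  forall f, centered s1 nu f ->
  exists2 g, centered s1 nu g & {in msupp g, forall m, i m <= i nu}.
Proof.
move=> hB hg.
(* Termination measure: the leading exponent descends along [below] within the finite set of
   exponents of degree at most that of [nu]. *)
pose rank mu := #|[set m : 'X_{1..n < (mdeg nu).+1} | below m mu]|.
suff H N f mu : (rank mu < N)%N -> centered s1 nu f -> leading f mu ->
    exists2 g, centered s1 nu g & {in msupp g, forall m, i m <= i nu}.
  move=> f cf; have [_ _ f1 _] := cf.
  have [|mu lmu] := @exists_leading f; last exact: H (ltnSn _) cf lmu.
  by apply: contraPneq f1 => ->; rewrite mcoeff0 => /eqP; rewrite eq_sym oner_eq0.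
elim: N f mu => // N IH f mu rN cf lmu.
have [imu|nu_mu] := lerP (i mu) (i nu).
  exists f => // m mf; have [->//|/(lmu.2 _ mf)/below_le] := eqVneq m mu.
  by move=> im; apply: le_trans imu.
have [If df f1 hf] := cf; have [muf hmu] := lmu.
have munu : mu != nu by apply: contraTneq nu_mu => ->; rewrite ltxx.
have [b bB bmu] := hB _ _ (leading_initial If df lmu).
have [g [Ig dg g1 [bg lg]] sg] := hg _ bB.
pose tau := (mu - b)%MM.
have tb : (tau + b)%MM = mu by rewrite submK.
pose f' := f - f@_mu *: ('X_[tau] * g).
have suppg m : m \in msupp ('X_[tau] * g) -> exists2 m', m' \in msupp g & m = (tau + m')%MM.
  move=> /msuppM_le /allpairsP[[x y] /= []]; rewrite msuppX inE => /eqP-> yg ->.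
  by exists y.
have gmu : ('X_[tau] * g)@_mu = 1.
  by rewrite mulrC -[X in _@_X]tb mcoeffMX.
have f'mu : f'@_mu = 0 by rewrite mcoeffB mcoeffZ gmu mulr1 subrr.
have snumu : sheared L0 i s1 nu < sheared L0 i s1 mu by exact: hf.
have gsh m : m \in msupp ('X_[tau] * g) -> sheared L0 i s1 mu <= sheared L0 i s1 m.
  by move=> /suppg[m' /sg h ->]; rewrite -tb !shearedD // lerD2l.
have suppf' m : m \in msupp f' -> m \in msupp f \/ m \in msupp ('X_[tau] * g).
  by move=> /msuppB_le; rewrite mem_cat => /orP[|/msuppZ_le]; [left|right].
have cf' : centered s1 nu f'.
  split.
  - by apply: idealB HI.1 _ _ If _; apply: idealZ HI.1 _ _ _; apply: idealM HI.1 _ _ Ig.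
  - move=> m /suppf'[/df//|/suppg[m' /dg dm' ->]].
    by rewrite mdegD dm' -mdegD tb df.
  - have /memN_msupp_eq0 nug : nu \notin msupp ('X_[tau] * g).
      by apply/negP => /gsh; rewrite leNgt snumu.
    by rewrite mcoeffB mcoeffZ f1 nug mulr0 subr0.
  move=> m /suppf'[/hf//|/gsh h _]; exact: lt_le_trans h.
have f'0 : f' != 0.
  have [_ _ + _] := cf'; apply: contraPneq => ->.
  by rewrite mcoeff0 => /eqP; rewrite eq_sym oner_eq0.
have [mu' lmu'] := exists_leading f'0.
have mu'mu : mu' != mu.
  by apply: contraTneq lmu'.1 => ->; rewrite mcoeff_msupp f'mu eqxx.
have bmu' : below mu' mu.
  have [/hmu->//|/suppg[m' m'g e]] := suppf' _ lmu'.1.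
  rewrite e -tb; apply: below_add; apply: lg => //.
  by apply: contra mu'mu => /eqP m'b; rewrite e m'b tb.
have [_ df' _ _] := cf'.
have dmu' : (mdeg mu' < (mdeg nu).+1)%N by rewrite df' //; exact: lmu'.1.
apply: IH cf' lmu'; suff lt : (rank mu' < rank mu)%N by apply: leq_trans lt _.
apply: proper_card; apply/properP; split.
  by apply/fintype.subsetP => m; rewrite !inE => h; exact: below_trans bmu'.
by exists (BMultinom dmu'); rewrite inE //= below_irr.
Qed.

Lemma exists_left_positive : (forall s, positive_at I L0 i s) ->
  exists s, left_positive I L0 i s.
Proof.
move=> pos; have [B [s1 [hB hg]]] := exists_groebner.
have [nu [f cf]] := centered_of_positive (pos s1).
have [g [Ig dg g1 cg] ig] := centered_reduce hB hg cf.
exists s1, nu, (g - 'X_[nu]); rewrite addrC subrK; split=> // m.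
have [->|mnu] := eqVneq m nu.
  by rewrite mcoeff_msupp mcoeffB g1 mcoeffX eqxx subrr eqxx.
move=> /msuppB_le; rewrite mem_cat msuppX inE (negPf mnu) orbF => mg.
by rewrite /coneR subr_gt0 cg //= mul0r lerz0 subr_le0 ig.
Qed.

End AtInfinity.

(** * Tropical varieties and homogeneous parts *)

Section Weights.
Variables (R : realType) (n : nat).
Implicit Types (w : 'rV[R]_n) (v : 'rV[int]_n) (a b : 'X_{1..n}).

Definition idot v a : int := \sum_(k < n) v 0 k * (a k)%:Z.

Lemma wdotD w a b : wdot w (a + b)%MM = wdot w a + wdot w b.
Proof.
by rewrite /wdot -big_split; apply: eq_bigr => k _; rewrite mnmDE natrD mulrDr.
Qed.

Lemma idotD v a b : idot v (a + b)%MM = idot v a + idot v b.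
Proof.
by rewrite /idot -big_split; apply: eq_bigr => k _; rewrite mnmDE PoszD mulrDr.
Qed.

Lemma wdotDl w w' a : wdot (w + w') a = wdot w a + wdot w' a.
Proof. by rewrite /wdot -big_split; apply: eq_bigr => k _; rewrite mxE mulrDl. Qed.

Lemma wdotZl s w a : wdot (s *: w) a = s * wdot w a.
Proof. by rewrite /wdot mulr_sumr; apply: eq_bigr => k _; rewrite mxE mulrA. Qed.

Lemma wdot_int v a : wdot (int_mx R v) a = (idot v a)%:~R.
Proof.
by rewrite /wdot /idot rmorph_sum; apply: eq_bigr => k _; rewrite mxE rmorphM.
Qed.

Lemma wdot_mul l (y : 'rV[R]_l) (u : 'M[int]_(l, n)) a :
  wdot (y *m int_mx R u) a = \sum_(j < l) y 0 j * (idot (row j u) a)%:~R.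
Proof.
rewrite mulmx_sum_row -[LHS]/(\sum_(k < n) _).
under eq_bigr => k _ do rewrite summxE mulr_suml.
rewrite exchange_big; apply: eq_bigr => j _ /=.
by rewrite -map_row -wdot_int -wdotZl.
Qed.
End Weights.

Section InitialForm.
Variables (R : realType) (K : comNzRingType) (n : nat).

Lemma is_monomial_initialP (w : 'rV[R]_n) (f : {mpoly K[n]}) :
  reflect (exists2 nu, nu \in msupp f &
             {in msupp f, forall m, m != nu -> wdot w nu < wdot w m})
          (is_monomial (initial_form w f)).
Proof.
pose P nu := all (fun m => wdot w nu <= wdot w m) (msupp f).
have -> : initial_form w f = mfilter P f by [].
have mP m : (m \in msupp (mfilter P f)) = P m && (m \in msupp f) := msupp_mfilter P f m.
apply: (iffP idP) => [|[nu nuf hnu]].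
  rewrite /is_monomial; case e : (msupp _) => [|nu [|]] // _.
  have := mP nu; rewrite e inE eqxx => /esym/andP[/allP Pnu nuf].
  exists nu => // m mf mnu; rewrite lt_neqAle Pnu // andbT.
  apply: contra mnu => /eqP wm; rewrite -mem_seq1 -e mP mf andbT.
  by apply/allP => m' /Pnu; rewrite wm.
have Pnu : P nu.
  by apply/allP => m mf; have [->//|/(hnu _ mf)/ltW] := eqVneq m nu.
rewrite /is_monomial (_ : 1%N = size [:: nu]) //; apply/eqP/perm_size.
apply: uniq_perm; rewrite ?msupp_uniq // => m; rewrite mP inE.
apply/andP/eqP => [[/allP Pm mf]|->//].
apply/eqP; apply: contraT => /(hnu _ mf); by rewrite ltNge Pm.
Qed.

Lemma trop_sub (I J : {mpoly K[n]} -> Prop) (w : 'rV[R]_n) :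
  (forall f, J f -> I f) -> trop I w -> trop J w.
Proof. by move=> JI tI f /JI /tI. Qed.
End InitialForm.

Section HomogeneousPart.
Variables (K : comNzRingType) (n : nat).

Lemma mfilter_mulX (P Q : pred 'X_{1..n}) m (f : {mpoly K[n]}) :
  (forall m', P (m + m')%MM = Q m') -> mfilter P ('X_[m] * f) = 'X_[m] * mfilter Q f.
Proof.
move=> PQ; rewrite {1}(mpolyE f) [in RHS](mpolyE f) mulr_sumr !raddf_sum mulr_sumr.
apply: eq_bigr => k _ /=; rewrite -scalerAr !linearZ /= -mpolyXD !mfilterX PQ -scalerAr.
by case: (Q k); rewrite ?mpolyXD ?mulr0.
Qed.

(* Only the first k rows of u are taken into account. *)
Definition fiber l (u : 'M[int]_(l, n)) k (c : 'I_l -> int) : pred 'X_{1..n} :=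
  fun nu => [forall j : 'I_l, (j < k)%N ==> (idot (row j u) nu == c j)].

(** For an ideal [I], this is the largest ideal inside [I] that is homogeneous for the first [k]
    rows of [u]. *)
Definition star (I : {mpoly K[n]} -> Prop) l (u : 'M[int]_(l, n)) k (g : {mpoly K[n]}) :=
  forall c, I (mfilter (fiber u k c) g).

Definition star1 (I : {mpoly K[n]} -> Prop) (v : 'rV[int]_n) (g : {mpoly K[n]}) :=
  forall c, I (mfilter (fun nu => idot v nu == c) g).

Lemma star_graded (I : {mpoly K[n]} -> Prop) l (u : 'M[int]_(l, n)) k :
  graded_ideal I -> graded_ideal (star I u k).
Proof.
move=> [HI GI]; split; first split.
- by move=> c; rewrite raddf0; exact: ideal0.
- by move=> f g If Ig c; rewrite raddfD; exact: (idealD HI (If c) (Ig c)).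
- move=> a f If c; rewrite (mpolyE a) mulr_suml raddf_sum; apply: ideal_sum => // m _.
  rewrite -scalerAl /= linearZ; apply: idealZ => //=.
  rewrite (@mfilter_mulX _ (fiber u k (fun j => c j - idot (row j u) m))).
    exact: (idealM HI _ (If _)).
  move=> m'; apply: eq_forallb => j; rewrite idotD; congr (_ ==> _).
  by rewrite [RHS]eq_sym subr_eq eq_sym addrC.
move=> f d If c.
have -> : mfilter (fiber u k c) (hcomp d f) = hcomp d (mfilter (fiber u k c) f).
  rewrite -[hcomp d f]/(mfilter (fun nu => mdeg nu == d) f).
  rewrite -[hcomp d _]/(mfilter (fun nu => mdeg nu == d) _) !mfilterI.
  by apply: eq_mfilter => m /=; rewrite andbC.
exact: GI.
Qed.

Lemma star1_starS (I : {mpoly K[n]} -> Prop) l (u : 'M[int]_(l, n)) (k : 'I_l) g :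
  star1 (star I u k) (row k u) g -> star I u k.+1 g.
Proof.
move=> sg c; have := sg (c k) c; rewrite mfilterI.
rewrite (@eq_mfilter _ _ _ (fiber u k.+1 c)) // => m /=.
apply/andP/forallP => [[/forallP h1 h2] j|h]; last split.
- apply/implyP; rewrite ltnS leq_eqVlt => /orP[/eqP/val_inj->//|jk].
  exact: implyP (h1 j) jk.
- apply/forallP => j; apply/implyP => jk; apply: (implyP (h j)); exact: ltnW.
- exact: (implyP (h k)).
Qed.
End HomogeneousPart.

(** * Tropical varieties of homogeneous parts *)

Section Projection.
Variables (R : realType) (K : fieldType) (n : nat).
Implicit Type I : {mpoly K[n]} -> Prop.

Lemma trop_star1 I (v : 'rV[int]_n) (w : 'rV[R]_n) : graded_ideal I ->
  trop (star1 I v) w -> exists s, trop I (w + s *: int_mx R v).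
Proof.
move=> GI ts; apply: contrapT => nt.
have wD := @wdotD R n w; have vD := @idotD n v.
have vND a b : - idot v (a + b)%MM = - idot v a - idot v b by rewrite vD opprD.
(* As no point of the line lies in T(I), each [s] yields an element with monomial initial form,
   which is then normalised. *)
have pos s : positive_at I (wdot w) (idot v) s.
  have [f If] : exists2 f, I f & is_monomial (initial_form (w + s *: int_mx R v) f).
    apply: contrapT => nf; apply: nt; exists s => f If.
    by apply/negP => mf; apply: nf; exists f.
  case/is_monomial_initialP => nu nuf hnu.
  exists nu, ((f@_nu)^-1 *: f - 'X_[nu]); rewrite addrC subrK; split.
    exact: idealZ GI.1 _ _ If.
  rewrite mcoeff_msupp in nuf => m; have [->|mnu] := eqVneq m nu.
    by rewrite mcoeff_msupp mcoeffB mcoeffZ mulVf // mcoeffX eqxx subrr eqxx.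
  move=> /msuppB_le; rewrite mem_cat msuppX inE (negPf mnu) orbF => /msuppZ_le /hnu.
  by rewrite !wdotDl !wdotZl !wdot_int /sheared subr_gt0; apply.
have lp := exists_left_positive GI wD vD pos.
have rp := exists_left_positive GI wD vND (positive_atN pos).
have [nu [h [Ih hh]]] := monic_homogeneous GI.1 wD vD pos lp rp.
have nuh : nu \notin msupp h by apply/negP => /hh; rewrite subrr ltxx.
(* All terms share the v-degree of [nu], so every graded component is either the whole element or
   0. *)
have sg : star1 I v ('X_[nu] + h).
  move=> c; have [<-|cnu] := eqVneq (idot v nu) c.
    rewrite mfilter_id // => m /msuppD_le; rewrite mem_cat msuppX inE.
    case/predU1P=> [->//|/hh/andP[_]].
    by rewrite intr_eq0 subr_eq0.
  rewrite (_ : mfilter _ _ = 0); first exact: ideal0 GI.1.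
  apply/mpolyP => m; rewrite mcoeff_mfilter mcoeff0; case: eqP => // vm.
  apply: memN_msupp_eq0; apply/negP => /msuppD_le; rewrite mem_cat msuppX inE.
  case/predU1P=> [mnu|/hh/andP[_]]; first by rewrite -vm mnu eqxx in cnu.
  by rewrite intr_eq0 subr_eq0 vm eq_sym (negPf cnu).
have /negP := ts _ sg; apply; apply/is_monomial_initialP; exists nu.
  by rewrite mcoeff_msupp mcoeffD mcoeffX eqxx memN_msupp_eq0 // addr0 oner_eq0.
move=> m /msuppD_le; rewrite mem_cat msuppX inE => /orP[->//|/hh/andP[]].
by rewrite subr_gt0.
Qed.

(** Rows are removed one at a time, starting from the last: [trop_star1] applies to the homogeneous
    part for the earlier rows, which is again a graded ideal. *)
Lemma trop_star I l (u : 'M[int]_(l, n)) k (w : 'rV[R]_n) : graded_ideal I ->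
  (k <= l)%N -> trop (star I u k) w -> exists y : 'rV[R]_l, trop I (w + y *m int_mx R u).
Proof.
move=> GI; elim: k w => [|k IH] w kl tw.
  exists 0; rewrite mul0mx addr0; apply: trop_sub tw => f If c.
  by rewrite mfilter_id // => m _; apply/forallP.
have [s ts] := trop_star1 (star_graded u k GI)
  (trop_sub (@star1_starS _ _ I _ u (Ordinal kl)) tw).
have [y ty] := IH _ (ltnW kl) ts.
exists (s *: delta_mx 0 (Ordinal kl) + y).
by rewrite mulmxDl -scalemxAl -rowE addrA -map_row.
Qed.

(** On a single graded component the weight [y *m int_mx R u] is constant, so the component
    containing a monomial initial term at the shifted point has the same one at [w]. *)
Lemma star_trop I l (u : 'M[int]_(l, n)) (w : 'rV[R]_n) (y : 'rV[R]_l) :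
  trop I w -> trop (star I u l) (w + y *m int_mx R u).
Proof.
move=> tI g sg; apply/is_monomial_initialP => -[nu nug hnu].
have /negP := tI _ (sg (fun j => idot (row j u) nu)); apply.
apply/is_monomial_initialP; exists nu.
  by rewrite msupp_mfilter nug andbT; apply/forallP => j; rewrite eqxx implybT.
move=> m; rewrite msupp_mfilter => /andP[/forallP fm mg] /(hnu _ mg).
rewrite !wdotDl !wdot_mul [X in _ < _ + X](eq_bigr (fun j => y 0 j * (idot (row j u) nu)%:~R)).
  by rewrite ltrD2r.
by move=> j _; have := fm j; rewrite ltn_ord => /eqP->.
Qed.
End Projection.

(** * The ideal Jtilde0 *)

Section Congruence.
Variables (K : comNzRingType) (N : nat).
Implicit Types (p q : {mpoly K[N]}) (S W : {mpoly K[N]} -> Prop).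

Lemma ideal_gen_ideal S : is_ideal (ideal_gen S).
Proof.
split.
- exists 0%N, (fun _ => 0), (fun _ => 0); split; first by case.
  by rewrite big_ord0.
- move=> f g [k [a [s [Ss ->]]]] [k' [a' [s' [Ss' ->]]]].
  exists (k + k')%N.
  exists (fun i => match split i with inl j => a j | inr j => a' j end).
  exists (fun i => match split i with inl j => s j | inr j => s' j end).
  split=> [i|]; first by case: (split i).
  rewrite big_split_ord /=; congr (_ + _); apply: eq_bigr => j _.
    by rewrite -[lshift _ _]/(unsplit (inl j)) unsplitK.
  by rewrite -[rshift _ _]/(unsplit (inr j)) unsplitK.
- move=> b f [k [a [s [Ss ->]]]]; exists k, (fun i => b * a i), s; split=> //.
  by rewrite mulr_sumr; apply: eq_bigr => i _; rewrite mulrA.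
Qed.

Lemma ideal_gen_sub S s : S s -> ideal_gen S s.
Proof. by move=> Ss; exists 1%N, (fun _ => 1), (fun _ => s); rewrite big_ord1 mul1r. Qed.

Definition congr_mod W p q := W (p - q).

Variables (W : {mpoly K[N]} -> Prop) (HW : is_ideal W).

Lemma congr_refl p : congr_mod W p p.
Proof. by rewrite /congr_mod subrr; exact: ideal0. Qed.

Lemma congr_sym p q : congr_mod W p q -> congr_mod W q p.
Proof. by move=> pq; rewrite /congr_mod -opprB -scaleN1r; exact: idealZ. Qed.

Lemma congr_trans q p r : congr_mod W p q -> congr_mod W q r -> congr_mod W p r.
Proof. by move=> pq qr; rewrite /congr_mod -(subrKA q); exact: idealD. Qed.

Lemma congr_mul p p' q q' : congr_mod W p q -> congr_mod W p' q' ->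
  congr_mod W (p * p') (q * q').
Proof.
move=> pq pq'; rewrite /congr_mod.
have -> : p * p' - q * q' = p * (p' - q') + q' * (p - q) by ring.
by apply: idealD => //; apply: idealM.
Qed.

Lemma congr_prod (J : Type) (r : seq J) (F G : J -> {mpoly K[N]}) :
  (forall j, congr_mod W (F j) (G j)) ->
  congr_mod W (\prod_(j <- r) F j) (\prod_(j <- r) G j).
Proof.
move=> FG; elim/big_rec2: _ => [|j p q _]; [exact: congr_refl|exact: congr_mul].
Qed.

Lemma congr_exp p a : congr_mod W p 1 -> congr_mod W (p ^+ a) 1.
Proof.
move=> p1; elim: a => [|a IH]; first exact: congr_refl.
by rewrite exprS -[1]mulr1; exact: congr_mul.
Qed.

End Congruence.

Section WeightHomogeneous.
Variables (K : comNzRingType) (n : nat).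
Implicit Types (v : 'rV[int]_n) (p q : {mpoly K[n]}).

Definition whomog v (d : int) p := {in msupp p, forall m, idot v m = d}.

Lemma whomogM v d e p q : whomog v d p -> whomog v e q -> whomog v (d + e) (p * q).
Proof.
by move=> hp hq m /msuppM_le/allpairsP[[a b] /= [/hp<- /hq<- ->]]; rewrite idotD.
Qed.

Lemma whomogXm v m : whomog v (idot v m) 'X_[m].
Proof. by move=> k; rewrite msuppX inE => /eqP->. Qed.

Lemma idotU v k : idot v U_(k)%MM = v 0 k.
Proof.
rewrite /idot (bigD1 k) //= mnm1E eqxx mulr1 big1 ?addr0 // => j jk.
by rewrite mnm1E eq_sym (negPf jk) mulr0.
Qed.

Lemma whomogX v k : whomog v (v 0 k) 'X_k.
Proof. by rewrite -{1}idotU; exact: whomogXm. Qed.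

Lemma whomog1 v : whomog v 0 1.
Proof.
move=> m; rewrite msupp1 inE => /eqP->.
by rewrite /idot big1 // => k _; rewrite mnm0E mulr0.
Qed.

Lemma whomog_prod v (J : Type) (r : seq J) (d : J -> int) (F : J -> {mpoly K[n]}) :
  (forall j, whomog v (d j) (F j)) ->
  whomog v (\sum_(j <- r) d j) (\prod_(j <- r) F j).
Proof.
move=> hF; elim/big_rec2: _ => [|j p e _]; [exact: whomog1|exact: whomogM].
Qed.

Lemma whomog_exp v d p a : whomog v d p -> whomog v (d * a%:Z) (p ^+ a).
Proof.
move=> hp; elim: a => [|a IH]; first by rewrite mulr0; exact: whomog1.
by rewrite exprS -addn1 PoszD addrC mulrDr mulr1; exact: whomogM.
Qed.

Lemma mfilter_whomog l (u : 'M[int]_(l, n)) c (d : 'I_l -> int) p :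
  (forall j, whomog (row j u) (d j) p) ->
  mfilter (fiber u l c) p = if [forall j, d j == c j] then p else 0.
Proof.
move=> hp; have e m : m \in msupp p -> fiber u l c m = [forall j, d j == c j].
  by move=> mp; apply: eq_forallb => j; rewrite ltn_ord (hp j _ mp).
apply/mpolyP => m; rewrite mcoeff_mfilter [in RHS]fun_if mcoeff0.
have [/e->//|mp] := boolP (m \in msupp p).
by rewrite memN_msupp_eq0 // !if_same.
Qed.

Lemma mfilterM_whomog0 l (u : 'M[int]_(l, n)) c p q :
  (forall j, whomog (row j u) 0 q) ->
  mfilter (fiber u l c) (p * q) = mfilter (fiber u l c) p * q.
Proof.
move=> hq; rewrite (mpolyE p) mulr_suml !raddf_sum mulr_suml /=.
apply: eq_bigr => m _; rewrite -scalerAl !linearZ -scalerAl /=; congr (_ *: _).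
rewrite !(@mfilter_whomog _ u c (fun j => idot (row j u) m)).
- by case: ifP; rewrite ?mul0r.
- by move=> j; exact: whomogXm.
by move=> j; rewrite -[idot _ _]addr0; apply: whomogM => //; exact: whomogXm.
Qed.
End WeightHomogeneous.

(** * Identification of [Jtilde0] with the homogeneous part of [I] *)

Section TildeJ0.
Variables (K : comNzRingType) (n l : nat) (u : 'M[int]_(l, n)).
Local Notation P := {mpoly K[n + l + l]}.

(* The grading that makes every t_k and every lambda_j mu_j homogeneous of
   degree 0. *)
Definition grading : 'M[int]_(l, n + l + l) := row_mx (row_mx u (- 1%:M)) 1%:M.

Lemma whomog_xvar j k : whomog (row j grading) (u j k) (xvar K l k).
Proof.
have -> : u j k = row j grading 0 (lshift l (lshift l k)) by rewrite mxE !row_mxEl.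
exact: whomogX.
Qed.

Lemma whomog_lamvar j j' : whomog (row j grading) (- (j == j')%:Z) (lamvar K n j').
Proof.
have -> : - (j == j')%:Z = row j grading 0 (lshift l (rshift n j')).
  by rewrite mxE row_mxEl row_mxEr !mxE; case: eqP.
exact: whomogX.
Qed.

Lemma whomog_muvar j j' : whomog (row j grading) (j == j')%:Z (muvar K n j').
Proof.
have -> : (j == j')%:Z = row j grading 0 (rshift (n + l) j').
  by rewrite mxE row_mxEr !mxE; case: eqP.
exact: whomogX.
Qed.

(** The Laurent power lambda_j^c modulo [Wid], where mu_j is the inverse of lambda_j. *)
Definition laurent_var (j : 'I_l) (c : int) : P :=
  if 0 <= c then lamvar K n j ^+ `|c|%N else muvar K n j ^+ `|c|%N.

Lemma tvarE k : tvar K u k = xvar K l k * \prod_(j < l) laurent_var j (u j k).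
Proof. by []. Qed.

Lemma whomog_laurent_var j j' c :
  whomog (row j grading) (- ((j == j')%:Z * c)) (laurent_var j' c).
Proof.
rewrite /laurent_var; case: ifP => c0.
  rewrite -mulNr -{1}[c]gez0_abs //; apply/whomog_exp/whomog_lamvar.
have cn : c <= 0 by rewrite ltW // ltNge c0.
rewrite -mulrN; have -> : - c = `|c|%N by lia.
exact/whomog_exp/whomog_muvar.
Qed.

Lemma whomog_tvar j k : whomog (row j grading) 0 (tvar K u k).
Proof.
rewrite tvarE; have -> : 0 = u j k + \sum_(j' < l) (- ((j == j')%:Z * u j' k)).
  rewrite (bigD1 j) //= eqxx mul1r big1 ?addr0 ?subrr // => j' jj'.
  by rewrite eq_sym (negPf jj') mul0r oppr0.
apply: whomogM; first exact: whomog_xvar.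
by apply: whomog_prod => j'; exact: whomog_laurent_var.
Qed.

Lemma whomog_comp_tvar j (f : {mpoly K[n]}) :
  whomog (row j grading) 0 (f \mPo [tuple tvar K u k | k < n]).
Proof.
rewrite comp_mpolyEX => m /msupp_sum_le /flattenP[s /mapP[nu _ ->]].
move=> /msuppZ_le; rewrite comp_mpolyX; apply: (_ : whomog _ _ _).
have -> : 0 = \sum_(k < n) 0 * (nu k)%:Z by rewrite big1 // => k _; rewrite mul0r.
apply: whomog_prod => k; rewrite tnth_mktuple; apply: whomog_exp; exact: whomog_tvar.
Qed.

(* Specialization at lambda = mu = 1. *)
Definition forget_image (k : 'I_(n + l + l)) : {mpoly K[n]} :=
  match split k with
  | inl k' => match split k' with inl k => 'X_k | inr _ => 1 end
  | inr _ => 1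
  end.
Definition forget (p : P) : {mpoly K[n]} :=
  p \mPo [tuple forget_image k | k < n + l + l].
HB.instance Definition _ := GRing.RMorphism.copy forget
  (comp_mpoly [tuple forget_image k | k < n + l + l]).

Lemma forgetX k : forget 'X_k = forget_image k.
Proof. by rewrite /forget comp_mpolyXU -tnth_nth tnth_mktuple. Qed.

Lemma forget_xvar k : forget (xvar K l k) = 'X_k.
Proof.
rewrite forgetX /forget_image -[lshift l (lshift l k)]/(unsplit (inl _)) unsplitK.
by rewrite -[lshift l k]/(unsplit (inl _)) unsplitK.
Qed.

Lemma forget_lamvar j : forget (lamvar K n j) = 1.
Proof.
rewrite forgetX /forget_image -[lshift l (rshift n j)]/(unsplit (inl _)) unsplitK.
by rewrite -[rshift n j]/(unsplit (inr _)) unsplitK.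
Qed.

Lemma forget_muvar j : forget (muvar K n j) = 1.
Proof.
by rewrite forgetX /forget_image -[rshift (n + l) j]/(unsplit (inr _)) unsplitK.
Qed.

Lemma forget_tvar k : forget (tvar K u k) = 'X_k.
Proof.
rewrite tvarE rmorphM /= forget_xvar rmorph_prod big1 ?mulr1 // => j _.
by rewrite /laurent_var; case: ifP => _; rewrite rmorphXn /= ?forget_lamvar ?forget_muvar expr1n.
Qed.

Lemma forget_comp (t : 'I_n -> P) (f : {mpoly K[n]}) : (forall k, forget (t k) = 'X_k) ->
  forget (f \mPo [tuple t k | k < n]) = f.
Proof.
move=> ft; rewrite comp_mpolyEX rmorph_sum [RHS]mpolyE; apply: eq_bigr => m _ /=.
rewrite {1}/forget comp_mpolyZ -/(forget _); congr (_ *: _).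
rewrite comp_mpolyX rmorph_prod mpolyXE_id; apply: eq_bigr => k _ /=.
by rewrite tnth_mktuple rmorphXn /= ft.
Qed.

Lemma mfilter_xembed c (g : {mpoly K[n]}) :
  mfilter (fiber grading l c) (xembed l g) = xembed l (mfilter (fiber u l c) g).
Proof.
have -> : mfilter (fiber u l c) g =
    \sum_(m <- msupp g) g@_m *: mfilter (fiber u l c) 'X_[m].
  by rewrite {1}(mpolyE g) raddf_sum; apply: eq_bigr => m _ /=; rewrite linearZ.
rewrite /xembed comp_mpolyEX !raddf_sum /=.
apply: eq_bigr => m _; rewrite !linearZ /=; congr (_ *: _).
rewrite mfilterX comp_mpolyX (@mfilter_whomog _ _ _ _ _ (fun j => idot (row j u) m)).
  rewrite /fiber (_ : [forall j, _] = [forall j : 'I_l, (j < l)%N ==> (idot (row j u) m == c j)]).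
    by case: ifP; rewrite ?comp_mpolyX ?comp_mpoly0.
  by apply: eq_forallb => j; rewrite ltn_ord.
move=> j; rewrite /idot; apply: whomog_prod => k; rewrite tnth_mktuple mxE.
exact/whomog_exp/whomog_xvar.
Qed.

(** Take a graded component of g = h + w and set lambda = mu = 1. The generators of J_0 and W have
    degree 0, so only their cofactors are filtered; the former specialise to elements of [I], the
    latter to 0. *)
Lemma Jtilde0_star (I : {mpoly K[n]} -> Prop) g : is_ideal I ->
  Jtilde0 I u g -> star I u l g.
Proof.
move=> HI [_ [_ [[k [a [s [Ss ->]]]] [[k' [b [s' [Ss' ->]]]] eg]]]] c.
rewrite -(@forget_comp (@xvar K n l) (mfilter _ g) forget_xvar).
rewrite -/(xembed l _) -mfilter_xembed eg raddfD !raddf_sum /= rmorphD !rmorph_sum /=.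
rewrite [X in I (_ + X)]big1 ?addr0 => [|i _].
  apply: ideal_sum => // i _; have [f If ->] := Ss i.
  rewrite mfilterM_whomog0; last by move=> j; exact: whomog_comp_tvar.
  by rewrite rmorphM /= forget_comp ?forget_tvar //; [exact: idealM|exact: forget_tvar].
have [j ->] := Ss' i; rewrite mfilterM_whomog0 => [|j'].
  by rewrite rmorphM rmorphB rmorphM rmorph1 /= forget_lamvar forget_muvar mulr1 subrr mulr0.
move=> m /msuppB_le; rewrite mem_cat => /orP[|/whomog1->//].
have := whomogM (@whomog_lamvar j' j) (@whomog_muvar j' j); rewrite addNr; exact.
Qed.

Local Notation W := (@Wid K n l).
Local Notation "p =W q" := (congr_mod W p q) (at level 70).

Lemma Wid_ideal : is_ideal W. Proof. exact: ideal_gen_ideal. Qed.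

(** For exponents of opposite sign the common power of lambda_j mu_j is split off; it is 1 modulo
    [Wid]. *)
Lemma laurent_varD j c d : laurent_var j c * laurent_var j d =W laurent_var j (c + d).
Proof.
have HW := Wid_ideal.
have one a : (lamvar K n j * muvar K n j) ^+ a =W 1.
  by apply: congr_exp => //; apply: ideal_gen_sub; exists j.
have cancel a b : lamvar K n j ^+ a * muvar K n j ^+ b =W laurent_var j (a%:Z - b%:Z).
  rewrite /laurent_var subr_ge0 lez_nat; case: leqP => ab.
    have -> : `|a%:Z - b%:Z|%N = (a - b)%N by lia.
    rewrite -{1}(subnK ab) exprD -mulrA -exprMn -[X in _ =W X]mulr1.
    by apply: congr_mul => //; exact: congr_refl.
  have -> : `|a%:Z - b%:Z|%N = (b - a)%N by lia.
  rewrite -{1}(subnK (ltnW ab)) exprD mulrCA -exprMn -[X in _ =W X]mulr1.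
  by apply: congr_mul => //; exact: congr_refl.
rewrite {1 2}/laurent_var; case: ifP => c0; case: ifP => d0.
- have -> : laurent_var j (c + d) = lamvar K n j ^+ `|c|%N * lamvar K n j ^+ `|d|%N.
    by rewrite /laurent_var addr_ge0 // -exprD; congr (_ ^+ _); lia.
  exact: congr_refl.
- have -> : c + d = `|c|%N%:Z - `|d|%N%:Z by lia.
  exact: cancel.
- have -> : c + d = `|d|%N%:Z - `|c|%N%:Z by lia.
  by rewrite mulrC; exact: cancel.
have -> : laurent_var j (c + d) = muvar K n j ^+ `|c|%N * muvar K n j ^+ `|d|%N.
  rewrite /laurent_var ifF; first by rewrite -exprD; congr (_ ^+ _); lia.
  by apply/negbTE; lia.
exact: congr_refl.
Qed.

Definition laurent_mono (c : 'I_l -> int) : P := \prod_(j < l) laurent_var j (c j).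

Lemma laurent_monoD c d e : (forall j, e j = c j + d j) ->
  laurent_mono c * laurent_mono d =W laurent_mono e.
Proof.
move=> ecd; rewrite /laurent_mono -big_split /=.
by apply: congr_prod => [|j]; [exact: Wid_ideal|rewrite ecd; exact: laurent_varD].
Qed.

Lemma laurent_mono0 : laurent_mono (fun _ => 0) = 1.
Proof. by rewrite /laurent_mono big1. Qed.

Lemma congr_tvarX k a :
  tvar K u k ^+ a =W xvar K l k ^+ a * laurent_mono (fun j => u j k * a%:Z).
Proof.
have HW := Wid_ideal; elim: a => [|a IH].
  rewrite (_ : laurent_mono _ = 1) ?mulr1; first exact: congr_refl.
  by rewrite /laurent_mono big1 // => j _; rewrite mulr0.
rewrite !exprS; apply: (congr_trans HW) (congr_mul HW (congr_refl HW _) IH) _.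
rewrite tvarE -/(laurent_mono (fun j => u j k)) mulrACA.
apply: (congr_mul HW (congr_refl HW _)); apply: laurent_monoD => j.
by rewrite -addn1 PoszD addrC mulrDr mulr1.
Qed.

Lemma congr_tvar_prod (r : seq 'I_n) (nu : 'X_{1..n}) :
  \prod_(k <- r) tvar K u k ^+ nu k =W
  \prod_(k <- r) xvar K l k ^+ nu k *
    laurent_mono (fun j => \sum_(k <- r) u j k * (nu k)%:Z).
Proof.
have HW := Wid_ideal; elim: r => [|k r IH].
  rewrite !big_nil (_ : laurent_mono _ = 1) ?mulr1; first exact: congr_refl.
  by rewrite /laurent_mono big1 // => j _; rewrite big_nil.
rewrite !big_cons; apply: (congr_trans HW) (congr_mul HW (congr_tvarX k _) IH) _.
rewrite mulrACA; apply: (congr_mul HW (congr_refl HW _)); apply: laurent_monoD => j.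
by rewrite big_cons.
Qed.

(** Modulo [Wid], substituting t multiplies a homogeneous [g] by the Laurent monomial lambda^d;
    multiplying g(t) by lambda^(-d) recovers g(x). *)
Lemma homogeneous_Jtilde0 (I : {mpoly K[n]} -> Prop) g (d : 'I_l -> int) :
  I g -> (forall j, whomog (row j u) (d j) g) -> Jtilde0 I u g.
Proof.
move=> Ig hg; have HW := Wid_ideal.
pose h := laurent_mono (fun j => - d j) * (g \mPo [tuple tvar K u k | k < n]).
exists h, (xembed l g - h); split; last split; last by rewrite addrC subrK.
  exists 1%N, (fun _ => laurent_mono (fun j => - d j)).
  exists (fun _ => g \mPo [tuple tvar K u k | k < n]).
  by split=> [_|]; [exists g|rewrite big_ord1].
rewrite /h /xembed !comp_mpolyEX mulr_sumr -sumrB big_seq; apply: ideal_sum => // nu nug.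
rewrite -scalerAr -scalerBr; apply: idealZ => //; rewrite !comp_mpolyX.
under eq_bigr => k _ do rewrite tnth_mktuple.
under [X in _ - _ * X]eq_bigr => k _ do rewrite tnth_mktuple.
apply: (@congr_sym _ _ W HW).
have step := congr_mul HW (congr_refl HW (laurent_mono (fun j => - d j)))
  (congr_tvar_prod (index_enum 'I_n) nu).
apply: (congr_trans HW step).
rewrite mulrCA -[X in _ =W X]mulr1; apply: (congr_mul HW (congr_refl HW _)).
rewrite -laurent_mono0; apply: laurent_monoD => j.
rewrite -(hg j nu nug) /idot; under [X in - X]eq_bigr => k _ do rewrite mxE.
by rewrite addNr.
Qed.

Lemma Jtilde0D (I : {mpoly K[n]} -> Prop) f g :
  Jtilde0 I u f -> Jtilde0 I u g -> Jtilde0 I u (f + g).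
Proof.
move=> [h [w [Jh [Ww ef]]]] [h' [w' [Jh' [Ww' eg]]]].
exists (h + h'), (w + w'); split; first exact: (idealD (ideal_gen_ideal _)).
split; first exact: (idealD Wid_ideal).
by rewrite /xembed comp_mpolyD -!/(xembed l _) ef eg addrACA.
Qed.

Lemma Jtilde00 (I : {mpoly K[n]} -> Prop) : Jtilde0 I u 0.
Proof.
exists 0, 0; split; first exact: (ideal0 (ideal_gen_ideal _)).
by split; [exact: (ideal0 Wid_ideal)|rewrite /xembed comp_mpoly0 addr0].
Qed.

(** [g] is the finite sum of its graded components, each a homogeneous element of [I]. *)
Lemma star_Jtilde0 (I : {mpoly K[n]} -> Prop) g : star I u l g -> Jtilde0 I u g.
Proof.
move=> sg; pose deg nu := [ffun j => idot (row j u) nu].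
have fiberE c nu : fiber u l c nu = (deg nu == [ffun j => c j]).
  apply/forallP/eqP => [h|/ffunP h j]; last by have := h j; rewrite !ffunE ltn_ord => ->; rewrite eqxx.
  by apply/ffunP => j; rewrite !ffunE; apply/eqP; have := h j; rewrite ltn_ord.
have -> : g = \sum_(d <- undup (map deg (msupp g))) mfilter (fiber u l d) g.
  apply/mpolyP => m; rewrite raddf_sum /=.
  under eq_bigr => d _ do rewrite mcoeff_mfilter fiberE.
  have [mg|mg] := boolP (m \in msupp g); last first.
    by rewrite memN_msupp_eq0 // big1 // => d _; rewrite if_same.
  have deta (d : {ffun 'I_l -> int}) : [ffun j => d j] = d.
    by apply/ffunP => j; rewrite ffunE.
  rewrite (bigD1_seq (deg m)) ?undup_uniq ?mem_undup ?map_f //= deta eqxx.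
  rewrite big1 ?addr0 // => d dm; rewrite deta eq_sym (negPf dm) //.
apply: big_ind; [exact: Jtilde00|by move=> *; exact: Jtilde0D|] => d _.
apply: (@homogeneous_Jtilde0 _ _ d); first exact: sg.
move=> j m; rewrite msupp_mfilter => /andP[/forallP/(_ j)].
by rewrite ltn_ord => /eqP.
Qed.

End TildeJ0.

Theorem theorem6p1 (R : realType) (K : closedFieldType) (n m : nat)
    (charK0 : [pchar K] =i pred0)
    (I : {mpoly K[n]} -> Prop) (HI : graded_ideal I) (Hmn : (m < n)%N) :
  exists D : 'M[R]_n -> Prop,
    [/\ Pi_open m D, Pi_dense m D &
      forall A : 'M[rat]_(m.+1, n),
        rational_projection A -> D (kerPi R A) ->
        forall u : 'M[int]_(n - m - 1, n),
          row_free (int_mx R u) ->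
          (int_mx R u == kermx (real_mx R A)^T)%MS ->
          forall w : 'rV[R]_n,
            (exists2 w' : 'rV[R]_n, trop I w' & proj A w = proj A w')
            <-> trop (Jtilde0 I u) w].
Proof.
(* D is all of Pi; the empty intersection of subbasis sets witnesses openness. *)
exists (inPi m); split.
- by split=> // U HU; exists [::]; split=> //; split.
- by split=> // O [OPi _] [U OU]; exists U; split=> //; exact: OPi.
move=> A _ _ u _ uker w; split=> [[w' tw' ww']|tw].
  have /submxP[y ey] : (w - w' <= int_mx R u)%MS.
    rewrite (eqmxP uker); apply/sub_kermxP.
    by rewrite mulmxBl -/(proj A w) -/(proj A w') ww' subrr.
  have -> : w = w' + y *m int_mx R u by rewrite -ey addrC subrK.
  apply: (trop_sub _ (star_trop (u := u) y tw')) => g; exact: (Jtilde0_star HI.1).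
have [y ty] := trop_star HI (leqnn _) (trop_sub (@star_Jtilde0 _ _ _ u I) tw).
(* The rows of [u] span the kernel of the projection, so this shift does not change the image of
   [w]. *)
exists (w + y *m int_mx R u) => //.
have /sub_kermxP : (y *m int_mx R u <= kermx (real_mx R A)^T)%MS.
  by rewrite -(eqmxP uker) submxMl.
by rewrite /proj mulmxDl => ->; rewrite addr0.
Qed.
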